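(* For every integer $D\ge 3$, the set of $D$-edge-colorable graphs is nowhere dense in $\mathfrak{G}^{\bullet,\infty}_{\le D}$, and the set of $D$-edge-colorable graphs is nowhere dense in $\mathfrak{G}^{\bullet,\infty}_{=D}$.
   Context: Graphs are simple. A graph is $D$-edge-colorable if its edges can be colored with $D$ colors so that edges sharing an endpoint get distinct colors. For an integer $D\ge 3$, $\mathfrak{G}^{\bullet}_{\le D}$ is the set of connected rooted graphs $(G,x)$ of maximum degree at most $D$, up to root-preserving isomorphism. $\mathfrak{G}^{\bullet,\infty}_{\le D}$ is the subset of those with $G$ infinite, and $\mathfrak{G}^{\bullet,\infty}_{=D}$ is the subset of those with $G$ infinite and every vertex of degree exactly $D$. For $r\ge 0$, $B_r(G,x)$ is the subgraph of $G$ induced by the vertices at distance at most $r$ from $x$, rooted at $x$. The metric is $d^{\bullet}((G_1,v_1),(G_2,v_2))=\inf\{2^{-r} : B_r(G_1,v_1)\cong B_r(G_2,v_2)\}$ (root-preserving isomorphism); subsets carry the restricted metric. A subset $S$ of a space $X$ is nowhere dense in $X$ if every non-empty open $U\subseteq X$ contains a non-empty open $U'\subseteq U$ with $U'\cap S=\emptyset$. *)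

(* Defs.v *)
From HB Require Import structures.
From mathcomp Require Import all_boot all_order all_algebra.
From mathcomp Require Import generic_quotient.
From mathcomp Require Import all_classical all_reals topology.

Set Implicit Arguments.
Unset Strict Implicit.
Unset Printing Implicit Defensive.
Import Order.TTheory GRing.Theory Num.Theory.
Local Open Scope classical_set_scope.
Local Open Scope card_scope.
Local Open Scope quotient_scope.

(* Isomorphism classes of graphs form a choiceType below, so the universe of
   vertex types lies strictly below that of choiceType and predArgType: vertex
   types are built from nat, bool, prod, sum, option, seq, sig; 'I_n and
   set_type are too large. *)
Record sgraph := SGraph {
  vertex :> Type;
  adj : rel vertex;
  adj_sym : symmetric adj;
  adj_irrefl : irreflexive adj
}.
Arguments adj {s}.

Section SimpleGraph.
Variable G : sgraph.

Definition graph_connected : Prop :=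
  forall x y : G, exists2 p, path adj x p & last x p = y.

Definition neighbors (x : G) : set G := [set y | adj x y].

Definition max_degree_le (D : nat) : Prop :=
  forall x : G, neighbors x #<= `I_D.

Definition regular (D : nat) : Prop :=
  forall x : G, neighbors x #= `I_D.

Definition edges : set (set G) :=
  [set e | exists x y : G, adj x y /\ e = [set x; y]].

Definition edge_colorable (D : nat) : Prop :=
  exists c : set G -> 'I_D, forall e f : set G,
    edges e -> edges f -> e <> f -> e `&` f !=set0 -> c e <> c f.

(* the vertices at distance at most r from x: a shortest walk realizes the
   distance *)
Definition dist_ball (x : G) (r : nat) : set G :=
  [set y | exists p, [/\ path adj x p, last x p = y & size p <= r]].

Lemma dist_ball_center x r : dist_ball x r x.
Proof. by exists [::]. Qed.

Definition induced (A : set G) : sgraph :=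
  @SGraph {x : G | x \in A} (fun u v => adj (sval u) (sval v))
    (fun u v => adj_sym (sval u) (sval v)) (fun u => adj_irrefl (sval u)).

End SimpleGraph.

Record rooted_graph := RootedGraph { graph_of :> sgraph; root : graph_of }.
Arguments root : clear implicits.

Definition rooted_ball (G : rooted_graph) (r : nat) : rooted_graph :=
  @RootedGraph (induced (dist_ball (root G) r))
    (exist _ (root G) (mem_set (@dist_ball_center G (root G) r))).

Definition in_rooted_ball (G : rooted_graph) r (x : G)
  (xr : x \in dist_ball (root G) r) : rooted_ball G r := exist _ x xr.

Definition rooted_iso (G H : rooted_graph) : Prop :=
  exists f : G -> H,
    [/\ bijective f, f (root G) = root H & {mono f : x y / adj x y}].

Lemma rooted_iso_refl G : rooted_iso G G.
Proof. by exists id; split=> //; exists id. Qed.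

Lemma rooted_iso_sym G H : rooted_iso G H -> rooted_iso H G.
Proof.
move=> [f [[g fK gK] froot fadj]]; exists g; split; first by exists f.
- by rewrite -froot fK.
- by move=> x y; rewrite -fadj !gK.
Qed.

Lemma rooted_iso_trans G H K :
  rooted_iso G H -> rooted_iso H K -> rooted_iso G K.
Proof.
move=> [f [fbij froot fadj]] [g [gbij groot gadj]]; exists (g \o f); split.
- exact: bij_comp.
- by rewrite /= froot groot.
- by move=> x y; rewrite /= gadj fadj.
Qed.

Section RootedDistance.
Local Open Scope ring_scope.
Variable R : realType.

Definition rooted_dist (G H : rooted_graph) : R :=
  inf [set (2 ^- r : R) | r in
        [set r | rooted_iso (rooted_ball G r) (rooted_ball H r)]].

End RootedDistance.

Section Balls.

Lemma dist_ball0 (G : sgraph) (x y : G) : dist_ball x 0 y -> y = x.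
Proof. by move=> [[|z p] [_ <- ]]. Qed.

Lemma dist_ballS (G : sgraph) (x y : G) r : dist_ball x r.+1 y ->
  y = x \/ exists2 z, dist_ball x r z & adj z y.
Proof.
move=> [p]; case/lastP: p => [|p z] [pP lp sp]; first by left.
rewrite last_rcons in lp; subst z; right.
move: pP; rewrite rcons_path => /andP[pP pz]; exists (last x p) => //.
by exists p; rewrite size_rcons in sp.
Qed.

Lemma dist_ball_step (G : sgraph) (x y z : G) r :
  dist_ball x r z -> adj z y -> dist_ball x r.+1 y.
Proof.
move=> [p [pP lp sp]] zy; exists (rcons p y).
by rewrite rcons_path last_rcons size_rcons pP lp.
Qed.

Lemma dist_ball_le (G : sgraph) (x : G) r s :
  (r <= s)%N -> dist_ball x r `<=` dist_ball x s.
Proof. by move=> rs y [p [? ? /leq_trans/(_ rs) ?]]; exists p. Qed.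

Lemma rooted_ball_map (G H : rooted_graph) r
    (f : rooted_ball G r -> rooted_ball H r) :
  f (root _) = root _ -> {mono f : x y / adj x y} ->
  forall t, (t <= r)%N -> forall u : rooted_ball G r,
  dist_ball (root G) t (sval u) -> dist_ball (root H) t (sval (f u)).
Proof.
move=> froot fadj; elim=> [|t IH] tr u.
  move=> /dist_ball0 u0; rewrite (_ : u = root _) ?froot; last exact: val_inj.
  exact: dist_ball_center.
case/dist_ballS => [u0|[z tz zu]].
  rewrite (_ : u = root _) ?froot; last exact: val_inj.
  exact: dist_ball_center.
have rz : z \in dist_ball (root G) r.
  by apply/mem_set; apply: dist_ball_le tz; exact: ltnW.
apply: (@dist_ball_step _ _ _ (sval (f (in_rooted_ball rz)))).
  by apply: IH => //; exact: ltnW.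
by have /= := fadj (in_rooted_ball rz) u; rewrite zu => ->.
Qed.

Lemma rooted_ball_le (G H : rooted_graph) r s : (s <= r)%N ->
  rooted_iso (rooted_ball G r) (rooted_ball H r) ->
  rooted_iso (rooted_ball G s) (rooted_ball H s).
Proof.
move=> sr [f [[g fK gK] froot fadj]].
have groot : g (root _) = root _ by rewrite -froot fK.
have gadj : {mono g : x y / adj x y} by move=> x y; rewrite -fadj !gK.
have up (K : rooted_graph) (u : rooted_ball K s) :
    sval u \in dist_ball (root K) r.
  by apply/mem_set; apply: dist_ball_le sr _ _; apply/set_mem; exact: (svalP u).
pose lift (K : rooted_graph) (u : rooted_ball K s) : rooted_ball K r :=
  in_rooted_ball (up K u).
have fin (u : rooted_ball G s) : sval (f (lift G u)) \in dist_ball (root H) s.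
  apply/mem_set; apply: rooted_ball_map => //; apply/set_mem; exact: (svalP u).
have gin (u : rooted_ball H s) : sval (g (lift H u)) \in dist_ball (root G) s.
  apply/mem_set; apply: rooted_ball_map => //; apply/set_mem; exact: (svalP u).
pose f' (u : rooted_ball G s) : rooted_ball H s := in_rooted_ball (fin u).
pose g' (u : rooted_ball H s) : rooted_ball G s := in_rooted_ball (gin u).
exists f'; split.
- exists g' => u; apply: val_inj => /=.
    by rewrite (_ : lift H _ = f (lift G u)) ?fK//; exact: val_inj.
  by rewrite (_ : lift G _ = g (lift H u)) ?gK//; exact: val_inj.
- apply: val_inj => /=.
  by rewrite (_ : lift G _ = root _) ?froot//; exact: val_inj.
- by move=> u v; have /= := fadj (lift G u) (lift G v).
Qed.

Lemma rooted_iso_ball (G H : rooted_graph) r :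
  rooted_iso G H -> rooted_iso (rooted_ball G r) (rooted_ball H r).
Proof.
have ball_map (G' H' : rooted_graph) (f : G' -> H') :
    f (root _) = root _ -> {mono f : x y / adj x y} ->
    forall u, dist_ball (root G') r u -> dist_ball (root H') r (f u).
  move=> froot fadj u [p [pP <- sp]]; exists (map f p).
  by rewrite -froot last_map size_map path_map (eq_path (e' := adj)).
move=> [f [[g fK gK] froot fadj]].
have groot : g (root _) = root _ by rewrite -froot fK.
have gadj : {mono g : x y / adj x y} by move=> x y; rewrite -fadj !gK.
have fin (u : rooted_ball G r) : f (sval u) \in dist_ball (root H) r.
  apply/mem_set; apply: ball_map => //; apply/set_mem; exact: (svalP u).
have gin (u : rooted_ball H r) : g (sval u) \in dist_ball (root G) r.
  apply/mem_set; apply: ball_map => //; apply/set_mem; exact: (svalP u).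
exists (fun u => in_rooted_ball (fin u)); split.
- exists (fun u => in_rooted_ball (gin u)) => u; apply: val_inj => /=.
    by rewrite fK.
  by rewrite gK.
- by apply: val_inj => /=.
- by move=> u v; have /= := fadj (sval u) (sval v).
Qed.

Lemma rooted_ball0 (G H : rooted_graph) :
  rooted_iso (rooted_ball G 0) (rooted_ball H 0).
Proof.
have E (K : rooted_graph) (u : rooted_ball K 0) : u = root _.
  by apply: val_inj; apply: dist_ball0; apply/set_mem; exact: (svalP u).
exists (fun=> root _); split=> //.
  by exists (fun=> root _) => u; rewrite [RHS]E.
by move=> u v; rewrite (E _ u) (E _ v) !adj_irrefl.
Qed.

Lemma finite_dist_ball (G : sgraph) (D r : nat) (x : G) :
  max_degree_le G D -> finite_set (dist_ball x r).
Proof.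
move=> GD; elim: r => [|r IH].
  by apply: (@sub_finite_set _ _ [set x]) => // y /dist_ball0 ->.
apply: (@sub_finite_set _ _
    ([set x] `|` \bigcup_(z in dist_ball x r) neighbors z)).
  by move=> y /dist_ballS[->|[z rz zy]]; [left|right; exists z].
rewrite finite_setU; split; first exact: finite_set1.
apply: bigcup_finite => // z _.
by apply: card_le_finite (GD z) _; exact: finite_II.
Qed.

End Balls.

Lemma rooted_iso_limit (G H : rooted_graph) (D : nat) :
  graph_connected G -> max_degree_le G D ->
  graph_connected H -> max_degree_le H D ->
  (forall r, rooted_iso (rooted_ball G r) (rooted_ball H r)) -> rooted_iso G H.
Proof.
move=> Gc GD Hc HD isoGH.
have [U [ultraU ooU]] := @ultraFilterLemma nat \oo _.
have total (G' H' : rooted_graph)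
    (F : forall r, rooted_ball G' r -> rooted_ball H' r) :
    graph_connected G' -> max_degree_le H' D ->
    (forall r, F r (root _) = root _) ->
    (forall r, {mono F r : x y / adj x y}) ->
    forall v : G', exists w : H',
      U [set r | exists u : rooted_ball G' r, sval u = v /\ sval (F r u) = w].
  move=> Gc' HD' Froot Fadj v.
  pose P w r := exists u : rooted_ball G' r, sval u = v /\ sval (F r u) = w.
  have [p pP lp] := Gc' (root G') v.
  have vball r : (size p <= r)%N -> dist_ball (root G') r v.
    by move=> ?; exists p.
  have : U [set r | exists2 w, dist_ball (root H') (size p) w & P w r].
    apply: ooU; exists (size p) => // r /= pr.
    exists (sval (F r (in_rooted_ball (mem_set (vball r pr))))); last first.
      by eexists; split; last reflexivity.
    by apply: rooted_ball_map => //; apply: vball.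
  have /(@finite_seqP {classic H'})[s ->] :=
    finite_dist_ball (size p) (root H') HD'.
  elim: s => [|w s IH] /= Us.
    by case: (filter_not_empty U); apply: filterS Us => r [].
  have [|Uw] := in_ultra_setVsetC [set r | P w r] ultraU; first by exists w.
  apply: IH; apply: filterS (filterI Us Uw) => r [[w']] /=.
  rewrite inE => /orP[/eqP -> //|w's] Pw' _; by exists w'.
have FgP r : exists Fg : (rooted_ball G r -> rooted_ball H r) *
    (rooted_ball H r -> rooted_ball G r), [/\ cancel Fg.1 Fg.2,
    cancel Fg.2 Fg.1, Fg.1 (root _) = root _ & {mono Fg.1 : x y / adj x y}].
  by have [F [[g FK gK] Fr Fa]] := isoGH r; exists (F, g).
pose F r := (sval (cid (FgP r))).1; pose g r := (sval (cid (FgP r))).2.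
have FK r : cancel (F r) (g r) by rewrite /F /g; case: cid => -[? ?] [].
have gK r : cancel (g r) (F r) by rewrite /F /g; case: cid => -[? ?] [].
have Froot r : F r (root _) = root _ by rewrite /F; case: cid => -[? ?] [].
have Fadj r : {mono F r : x y / adj x y} by rewrite /F; case: cid => -[? ?] [].
have groot r : g r (root _) = root _ by rewrite -Froot FK.
have gadj r : {mono g r : x y / adj x y} by move=> x y; rewrite -Fadj !gK.
have [phi phiP] := choice (total G H F Gc HD Froot Fadj).
have [psi psiP] := choice (total H G g Hc GD groot gadj).
exists phi; split.
- exists psi => x.
    have [r [[u [ux uy]] [v [vx vy]]]] :=
      filter_ex (filterI (phiP x) (psiP (phi x))).
    have -> : psi (phi x) = sval (g r v) by [].
    by rewrite -ux (_ : v = F r u) ?FK//; apply: val_inj; rewrite /= vx uy.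
  have [r [[u [ux uy]] [v [vx vy]]]] :=
    filter_ex (filterI (psiP x) (phiP (psi x))).
  have -> : phi (psi x) = sval (F r v) by [].
  by rewrite -ux (_ : v = g r u) ?gK//; apply: val_inj; rewrite /= vx uy.
- have [r [u [ux <-]]] := filter_ex (phiP (root G)).
  by rewrite (_ : u = root _) ?Froot//; exact: val_inj.
- move=> x y.
  have [r [[u [<- <-]] [v [<- <-]]]] := filter_ex (filterI (phiP x) (phiP y)).
  exact: (Fadj r u v).
Qed.

Section Metric.
Local Open Scope ring_scope.
Variable R : realType.
Implicit Types G H K : rooted_graph.

Let radii G H : set nat :=
  [set r | rooted_iso (rooted_ball G r) (rooted_ball H r)].

Let dists_nonempty G H : [set (2 ^- r : R) | r in radii G H] !=set0.
Proof. by exists (2 ^- 0), 0%N => //; exact: rooted_ball0. Qed.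

Let dists_lbound G H : lbound [set (2 ^- r : R) | r in radii G H] 0.
Proof. by move=> _ [r _ <-]; rewrite invr_ge0 exprn_ge0. Qed.

Lemma rooted_dist_ge0 G H : 0 <= rooted_dist R G H.
Proof. by apply: lb_le_inf; [exact: dists_nonempty|exact: dists_lbound]. Qed.

Lemma rooted_dist_le G H r :
  rooted_iso (rooted_ball G r) (rooted_ball H r) ->
  rooted_dist R G H <= 2 ^- r.
Proof.
by move=> GH; apply: ge_inf; [exists 0; exact: dists_lbound|exists r].
Qed.

Lemma rooted_dist_lt G H r :
  rooted_dist R G H < 2 ^- r ->
  rooted_iso (rooted_ball G r.+1) (rooted_ball H r.+1).
Proof.
move=> /(inf_lt (dists_nonempty G H))[_ [s GHs <-]]; rewrite ltf_pV2 ?posrE ?exprn_gt0// => sr.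
apply: rooted_ball_le GHs; move: sr.
by rewrite ltr_eXn2l// ltr1n.
Qed.

Lemma rooted_dist_refl G H : rooted_iso G H -> rooted_dist R G H = 0.
Proof.
move=> GH; apply/eqP; rewrite eq_le rooted_dist_ge0 andbT.
apply/ler_addgt0Pl => e e0; rewrite addr0.
have := upper_nthrootP (leqnn (Num.bound e^-1)); set n := Num.bound _ => ne.
apply: le_trans (rooted_dist_le (rooted_iso_ball n GH)) _.
by rewrite -(invrK e) lef_pV2 ?posrE ?exprn_gt0 ?invr_gt0// ltW.
Qed.

Lemma rooted_dist_sym G H : rooted_dist R G H = rooted_dist R H G.
Proof.
congr (inf _); congr (image _ _); apply/seteqP.
by split=> r; exact: rooted_iso_sym.
Qed.

Lemma rooted_dist_triangle G H K :
  rooted_dist R G K <= rooted_dist R G H + rooted_dist R H K.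
Proof.
rewrite -lerBlDr; apply: lb_le_inf => [|_ [r GH <-]]; first exact: dists_nonempty.
rewrite lerBlDr addrC -lerBlDr; apply: lb_le_inf => [|_ [s HK <-]].
  exact: dists_nonempty.
rewrite lerBlDr; case: (leqP r s) => [rs|/ltnW sr].
  apply: (@le_trans _ _ (2 ^- r)); last by rewrite lerDr invr_ge0 exprn_ge0.
  apply: rooted_dist_le; apply: rooted_iso_trans GH _; exact: rooted_ball_le HK.
apply: (@le_trans _ _ (2 ^- s)); last by rewrite lerDl invr_ge0 exprn_ge0.
apply: rooted_dist_le; apply: rooted_iso_trans _ HK; exact: rooted_ball_le GH.
Qed.

Lemma rooted_dist_iso G H G' H' : rooted_iso G G' -> rooted_iso H H' ->
  rooted_dist R G H = rooted_dist R G' H'.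
Proof.
move=> GG HH; congr (inf _); congr (image _ _); apply/seteqP; split=> r /= iso_r.
  apply: rooted_iso_trans (rooted_iso_ball r (rooted_iso_sym GG)) _.
  exact: rooted_iso_trans iso_r (rooted_iso_ball r HH).
apply: rooted_iso_trans (rooted_iso_ball r GG) _.
exact: rooted_iso_trans iso_r (rooted_iso_ball r (rooted_iso_sym HH)).
Qed.

End Metric.

Section GraphSpace.
Local Open Scope ring_scope.

Record bounded_rooted_graph (D : nat) := BoundedRootedGraph {
  bounded_rooted :> rooted_graph;
  bounded_connected : graph_connected bounded_rooted;
  bounded_degree : max_degree_le bounded_rooted D
}.

HB.instance Definition _ D := gen_eqMixin (bounded_rooted_graph D).
HB.instance Definition _ D := gen_choiceMixin (bounded_rooted_graph D).

Definition rooted_isob D : rel (bounded_rooted_graph D) :=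
  fun G H => `[< rooted_iso G H >].

Lemma rooted_isob_equiv D : equiv_class_of (@rooted_isob D).
Proof.
split=> [G|G H|H G K].
- by apply/asboolP; exact: rooted_iso_refl.
- by apply/asbool_equiv_eq; split; exact: rooted_iso_sym.
- move=> /asboolP GH /asboolP HK; apply/asboolP; exact: rooted_iso_trans GH HK.
Qed.

Canonical rooted_isob_equiv_rel D := EquivRelPack (@rooted_isob_equiv D).

(* R is only the codomain of the metric; it is a parameter so that the metric
   structure on the type can be inferred *)
Definition graph_space (R : realType) (D : nat) :=
  {eq_quot (rooted_isob_equiv_rel D)}.

HB.instance Definition _ R D := Choice.on (graph_space R D).
HB.instance Definition _ R D := Quotient.on (graph_space R D).

Section GraphMetric.
Variables (R : realType) (D : nat).
Implicit Types a b c : graph_space R D.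

Lemma graph_space_eqP (G H : bounded_rooted_graph D) :
  \pi_(graph_space R D) G = \pi_(graph_space R D) H <-> rooted_iso G H.
Proof.
split=> [/eqmodP/asboolP //|GH]; exact/eqmodP/asboolP.
Qed.

Definition graph_dist a b : R := rooted_dist R (repr a) (repr b).

Lemma graph_dist_pi (G H : bounded_rooted_graph D) :
  graph_dist (\pi G) (\pi H) = rooted_dist R G H.
Proof. by apply: rooted_dist_iso; apply/graph_space_eqP; rewrite reprK. Qed.

Let graph_distxx a : graph_dist a a = 0.
Proof. by apply: rooted_dist_refl; exact: rooted_iso_refl. Qed.

Let graph_dist_positivity a b : graph_dist a b = 0 -> a = b.
Proof.
move=> ab; rewrite -(reprK a) -(reprK b); apply/graph_space_eqP.
apply: (@rooted_iso_limit _ _ D); try exact: bounded_connected;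
  try exact: bounded_degree.
move=> r; apply: (rooted_ball_le (leqnSn r)); apply: (@rooted_dist_lt R).
by rewrite [rooted_dist _ _ _]ab invr_gt0 exprn_gt0.
Qed.

Let graph_dist_sym a b : graph_dist a b = graph_dist b a.
Proof. exact: rooted_dist_sym. Qed.

Let graph_dist_triangle b a c :
  graph_dist a c <= graph_dist a b + graph_dist b c.
Proof. exact: rooted_dist_triangle. Qed.

HB.instance Definition _ := @isMetric.Build R (graph_space R D)
  graph_dist graph_distxx graph_dist_positivity graph_dist_sym
  graph_dist_triangle.

Definition graph_class (P : set sgraph) : set (graph_space R D) :=
  [set \pi_(graph_space R D) G | G in [set G : bounded_rooted_graph D | P G]].

Definition infinite_graphs : set (graph_space R D) :=
  graph_class [set G : sgraph | infinite_set [set: G]].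

Definition infinite_regular_graphs : set (graph_space R D) :=
  graph_class [set G : sgraph | infinite_set [set: G] /\ regular G D].

Definition colorable_graphs : set (graph_space R D) :=
  graph_class [set G : sgraph | edge_colorable G D].

End GraphMetric.
End GraphSpace.
Arguments infinite_graphs : clear implicits.
Arguments infinite_regular_graphs : clear implicits.
Arguments colorable_graphs : clear implicits.

Definition nowhere_dense (X : topologicalType) (S : set X) : Prop :=
  forall U : set X, open U -> U !=set0 ->
    exists U' : set X, [/\ open U', U' !=set0, U' `<=` U & U' `&` S = set0].

(* For A : set X, the type A carries the topology induced by X. *)
Definition nowhere_dense_in (X : topologicalType) (A S : set X) : Prop :=
  @nowhere_dense A (set_val @^-1` S).

(* Main.v *)
(* Far away from the root, subdivide an edge uv by a vertex w and attach to w
   the rest of a finite gadget, through D - 2 edges. Degrees are preserved, so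
   the new graph stays in the space and is close to the old one. Every vertex of
   the gadget other than w has degree D, so in a D-edge-coloring all colors
   appear at it, while among the gadget edges at w some color appears and some
   color does not. Counting the endpoints of the gadget edges of those two
   colors gives two consecutive even numbers. The obstruction lies in a finite
   ball, hence it persists on a whole neighborhood. *)
Require Import Defs.
From mathcomp Require Import all_boot all_order all_algebra generic_quotient.
From mathcomp Require Import zify.
From mathcomp Require Import all_classical all_reals topology.

Set Implicit Arguments.
Unset Strict Implicit.
Unset Printing Implicit Defensive.
Import Order.TTheory GRing.Theory Num.Theory.
Local Open Scope set_scope.

(** * Parity obstruction to edge colorings of finite graphs *)

Lemma even_card_sym_rel (T : finType) (r : rel T) :
  symmetric r -> irreflexive r -> ~~ odd #|[set p : T * T | r p.1 p.2]|.
Proof.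
move=> rs ri; set P := finset _.
(* A linear order on [T] splits [P] into two halves exchanged by [swap]; irreflexivity leaves no
   pair on the diagonal. *)
pose lt (p : T * T) := (enum_rank p.1 < enum_rank p.2)%N.
pose swap (p : T * T) := (p.2, p.1).
have swapI : injective swap by move=> [a b] [c d] [-> ->].
rewrite -(cardsID [set p | lt p] P).
suff -> : P :\: [set p | lt p] = swap @: (P :&: [set p | lt p]).
  by rewrite card_imset // addnn odd_double.
apply/setP => -[a b]; rewrite !inE /lt /=; apply/andP/imsetP.
  case=> nlt rab; exists (b, a) => //; rewrite !inE /= rs rab /=.
  rewrite ltn_neqAle leqNgt nlt andbT; apply/eqP => /val_inj/enum_rank_inj ba.
  by rewrite ba ri in rab.
by case=> -[c d]; rewrite !inE /= => /andP[rcd cd] [-> ->];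
  rewrite rs -leqNgt ltnW.
Qed.

(* The vertices incident with a given colour are matched in pairs, so they are
   even in number. They are all vertices if the colour appears at w, and all
   vertices but w otherwise; both kinds of colours exist. *)
Lemma cut_vertex_uncolorable (T C : finType) (e : rel T) (col : T -> T -> C)
    (w : T) :
  symmetric e -> irreflexive e -> (forall x y, col x y = col y x) ->
  (forall x y z, e x y -> e x z -> col x y = col x z -> y = z) ->
  (forall x, x != w -> #|[set y | e x y]| = #|C|) ->
  0 < #|[set y | e w y]| < #|C| -> False.
Proof.
move=> es ei cs cI deg /andP[w0 wC].
pose S c := [set x | [exists y, e x y && (col x y == c)]].
have evenS c : ~~ odd #|S c|.
  (* Properness gives each vertex of [S c] a single partner, so [S c] is equinumerous with the
     ordered pairs joined by color [c]. *)
  pose r x y := e x y && (col x y == c).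
  have := @even_card_sym_rel _ r.
  suff -> : S c = fst @: [set p : T * T | r p.1 p.2].
    rewrite card_in_imset; first by apply=> [x y|x]; rewrite /r ?ei // es cs.
    move=> [a b] [a' d]; rewrite !inE /=.
    move=> /andP[ab /eqP cb] /andP[ad /eqP cd] aa.
    by subst a'; congr pair; apply: cI ab ad _; rewrite cb cd.
  apply/setP => x; rewrite inE; apply/existsP/imsetP => [[y rxy]|[[a b]]].
    by exists (x, y); rewrite ?inE.
  by rewrite inE /= => rab ->; exists b.
have colI x : {in [set y | e x y] &, injective (col x)}.
  by move=> y z; rewrite !inE; apply: cI.
have memS c x : x != w -> x \in S c.
  (* The [#|C|] edges at [x] have distinct colors, so every color occurs there. *)
  move=> xw; have : c \in col x @: [set y | e x y].
    suff -> : col x @: [set y | e x y] = [set: C] by rewrite inE.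
    apply/eqP; rewrite eqEcard finset.subsetT cardsT card_in_imset //.
    by rewrite deg //=.
  case/imsetP => y; rewrite !inE => xy ->.
  by apply/existsP; exists y; rewrite xy /=.
have [y] := card_gt0P w0; rewrite inE => wy.
have [c] : exists c, c \notin col w @: [set y | e w y].
  apply/existsP; rewrite -negb_forall; apply/negP => /forallP all.
  by move: wC; rewrite -(card_in_imset (colI w)) (eq_card (B := C)) ?ltnn //.
have := evenS c; have := evenS (col w y).
have -> : S (col w y) = [set: T].
  apply/setP => x; rewrite [RHS]inE; have [->|/memS->//] := eqVneq x w.
  by rewrite inE; apply/existsP; exists y; rewrite wy /=.
move=> evT + /imsetP nc.
have -> : S c = [set~ w].
  apply/setP => x; rewrite [RHS]inE finset.in_set1.
  have [->|/memS->//] := eqVneq x w.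
  apply/negP; rewrite inE => /existsP[z /andP[wz /eqP cz]].
  by apply: nc; exists z; rewrite ?inE.
by move: evT; rewrite cardsT; have := cardsC [set w]; rewrite cards1; lia.
Qed.

(** * The finite gadget *)

(* The complement of the gadget on {0, ..., D + 2} consists of the cycles
   0 - 1 - ... - D - 0 and 0 - (D + 1) - (D + 2) - 0, which share the vertex 0;
   hence the positive vertices have degree D and the vertex 0 has degree D - 2.
   [gadget_arc D] lists the edges (i, j) with i < j. *)
Definition gadget_arc (D i j : nat) : bool :=
  if i == 0 then 1 < j < D else (i.+1 < j) || ((i == D) && (j == D.+1)).

Definition gadget_adj (D : nat) : rel nat :=
  fun i j => gadget_arc D i j || gadget_arc D j i.

Lemma gadget_sym D : symmetric (gadget_adj D).
Proof. by move=> i j; rewrite /gadget_adj orbC. Qed.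

Lemma gadget_irrefl D : irreflexive (gadget_adj D).
Proof. by move=> i; rewrite /gadget_adj /gadget_arc; case: ifP; lia. Qed.

Lemma card_setC3 (T : finType) (a b c : T) :
  a != b -> a != c -> b != c -> #|~: [set a; b; c]| = #|T| - 3.
Proof.
move=> ab ac bc.
rewrite cardsCs finset.setCK -finset.setUA.
by rewrite cardsU1 cards2 !inE negb_or ab ac bc.
Qed.

Lemma gadget_degree D (i : 'I_D.+3) : 3 <= D -> i != ord0 ->
  #|[set j : 'I_D.+3 | gadget_adj D i j]| = D.
Proof.
rewrite -(inj_eq val_inj) /= => hD i0; have lti := ltn_ord i.
(* [p] and [n] are the neighbors of [i] on its cycle of the complement. Thus [i] is adjacent to all
   of the [D + 3] vertices except [i], [p] and [n]. *)
pose p := if i == D.+1 :> nat then 0 else i.-1.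
pose n := if (i == D :> nat) || (i == D.+2 :> nat) then 0 else i.+1.
have ltp : p < D.+3 by rewrite /p; case: ifP; lia.
have ltn : n < D.+3 by rewrite /n; case: ifP; lia.
rewrite (_ : finset _ = ~: [set i; Ordinal ltp; Ordinal ltn]).
  rewrite card_setC3 ?card_ord -?(inj_eq val_inj) /= /p /n ?subn3 //;
    by repeat case: ifP; lia.
apply/setP => j; have := ltn_ord j; rewrite !inE -!(inj_eq val_inj) /=.
rewrite /p /n /gadget_adj /gadget_arc (negbTE i0).
by move=> ?; repeat case: ifP; lia.
Qed.

Lemma gadget_root_nbrs D (j : 'I_D.+3) : gadget_adj D 0 j = (1 < j < D).
Proof. by rewrite /gadget_adj /gadget_arc /=; case: ifP; lia. Qed.

(** These slots index the [D] neighbors that vertex 0 has after splicing: 2, ..., D - 1 stay in the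
    gadget, while 1 and D stand for the ends of the subdivided edge. *)
Lemma card_root_slots D : 3 <= D ->
  #|[set j : 'I_D.+3 | 0 < j <= D]| = D.
Proof.
move=> hD; have lt2 : D.+1 < D.+3 by [].
rewrite (_ : finset _ = ~: [set ord0; Ordinal lt2; ord_max]).
  by rewrite card_setC3 ?card_ord ?subn3 // -?(inj_eq val_inj) /=; lia.
by apply/setP => j; have := ltn_ord j; rewrite !inE -!(inj_eq val_inj) /=; lia.
Qed.

Lemma gadget_root_degree D : 3 <= D ->
  0 < #|[set j : 'I_D.+3 | gadget_adj D 0 j]| < D.
Proof.
move=> hD; have lt2 : 2 < D.+3 by lia.
apply/andP; split.
  apply/card_gt0P; exists (Ordinal lt2).
  by rewrite inE gadget_root_nbrs /=; lia.
rewrite -[X in _ < X](card_root_slots hD).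
apply: proper_card; apply/properP; split.
  by apply/fintype.subsetP => j; rewrite !inE gadget_root_nbrs; lia.
have lt1 : 1 < D.+3 by lia.
by exists (Ordinal lt1); rewrite !inE ?gadget_root_nbrs /=; lia.
Qed.

Lemma gadget_uncolorable D (C : finType) (col : 'I_D.+3 -> 'I_D.+3 -> C) :
  3 <= D -> #|C| = D -> (forall i j, col i j = col j i) ->
  (forall i j k : 'I_D.+3, gadget_adj D i j -> gadget_adj D i k ->
     col i j = col i k -> j = k) -> False.
Proof.
move=> hD cC cs cI.
apply: (@cut_vertex_uncolorable _ _
  (fun i j : 'I_D.+3 => gadget_adj D i j) col ord0) => //.
- by move=> i j; exact: gadget_sym.
- by move=> i; exact: gadget_irrefl.
- by move=> i i0; rewrite cC gadget_degree.
- by rewrite cC gadget_root_degree.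
Qed.

Local Open Scope classical_set_scope.
Local Open Scope card_scope.
Local Open Scope quotient_scope.

(** The copy of the gadget need not be induced: a coloring of [K] pulls back along [f] to a proper
    coloring of the gadget. *)
Lemma gadget_hom_uncolorable (K : sgraph) (D : nat) (f : 'I_D.+3 -> K) :
  3 <= D -> injective f ->
  (forall i j : 'I_D.+3, gadget_adj D i j -> adj (f i) (f j)) ->
  ~ edge_colorable K D.
Proof.
move=> hD fI fhom [c cP].
apply: (@gadget_uncolorable D _ (fun i j => c [set f i; f j]) hD (card_ord D)).
  by move=> i j; rewrite setUC.
move=> i j k ij ik; apply: contraPP => jk; apply: cP.
- by exists (f i), (f j); split=> //; exact: fhom.
- by exists (f i), (f k); split=> //; exact: fhom.
- move=> E; have : [set f i; f k] (f j) by rewrite -E; right.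
  case=> /fI ji; last exact: jk.
  by subst j; rewrite gadget_irrefl in ij.
- by exists (f i); split; left.
Qed.

(** * Cardinality and reachability tools *)

(** Turns the finite counts in the gadget into the classical cardinalities by which degrees are
    defined. *)
Lemma card_eq_image_set n (A : {set 'I_n.+1}) (T : Type) (f : 'I_n.+1 -> T) :
  injective f -> f @` [set` A] #= `I_#|A|.
Proof.
move=> fI; apply: (card_eq_trans (B := [set` A])).
  by apply: inj_card_eq => x y _ _; exact: fI.
rewrite (_ : [set` A] = nth ord0 (enum A) @` `I_#|A|).
  apply: inj_card_eq => i j; rewrite !inE /= cardE => iA jA /eqP.
  by rewrite nth_uniq ?enum_uniq // => /eqP.
apply/seteqP; split => [x /= xA|_ [i /= iA <-]].
  by exists (index x (enum A));
    rewrite /= ?cardE ?index_mem ?nth_index ?mem_enum.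
by rewrite -mem_enum mem_nth // -cardE.
Qed.

Definition reachable (G : sgraph) (x y : G) : Prop :=
  exists2 p, path adj x p & last x p = y.

Lemma reachable_refl (G : sgraph) (x : G) : reachable x x.
Proof. by exists [::]. Qed.

Lemma reachable_adj (G : sgraph) (x y : G) : adj x y -> reachable x y.
Proof. by move=> xy; exists [:: y] => //=; rewrite xy. Qed.

Lemma reachable_trans (G : sgraph) (x y z : G) :
  reachable x y -> reachable y z -> reachable x z.
Proof.
move=> [p pP <-] [q qP <-]; exists (p ++ q); last by rewrite last_cat.
by rewrite cat_path pP.
Qed.

Lemma reachable_sym (G : sgraph) (x y : G) : reachable x y -> reachable y x.
Proof.
move=> [p pP <-]; elim: p x pP => [|z p IH] x /=; first by exists [::].
move=> /andP[xz /IH]; move/reachable_trans; apply.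
by apply: reachable_adj; rewrite adj_sym.
Qed.

(** * Splicing the gadget into an edge *)

Section Splice.
Variables (D : nat) (G : sgraph) (u v : G).

(* The edge uv is subdivided by the vertex 0 of the gadget. *)
Definition splice_vertex : Type := G + {i : nat | i < D.+3}.

Definition cut_edge (x y : G) : bool :=
  `[< (x = u /\ y = v) \/ (x = v /\ y = u) >].

Definition splice_adj : rel splice_vertex := fun x y =>
  match x, y with
  | inl a, inl b => adj a b && ~~ cut_edge a b
  | inl a, inr i | inr i, inl a => (sval i == 0) && `[< a = u \/ a = v >]
  | inr i, inr j => gadget_adj D (sval i) (sval j)
  end.

Lemma cut_edge_sym x y : cut_edge x y = cut_edge y x.
Proof. by apply: asbool_equiv_eq; split; tauto. Qed.

Lemma cut_edge_uv : cut_edge u v.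
Proof. by apply/asboolP; left. Qed.

Lemma splice_sym : symmetric splice_adj.
Proof.
case=> [a|i] [b|j]; last exact: gadget_sym; rewrite /splice_adj //.
by rewrite adj_sym cut_edge_sym.
Qed.

Lemma splice_irrefl : irreflexive splice_adj.
Proof. by case=> [a|i]; rewrite /splice_adj ?adj_irrefl ?gadget_irrefl. Qed.

Definition splice : sgraph := SGraph splice_sym splice_irrefl.

(** Vertex types must live in a small universe, which excludes ordinals; this map lets ordinals
    index the gadget all the same. *)
Definition gadget_vertex (i : 'I_D.+3) : splice :=
  inr (exist _ (val i) (ltn_ord i)).

Lemma gadget_vertex_inj : injective gadget_vertex.
Proof. by move=> i j [] /val_inj. Qed.

Lemma gadget_vertexP (k : {i : nat | i < D.+3}) :
  inr k = gadget_vertex (Ordinal (svalP k)).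
Proof. by congr inr; apply: val_inj. Qed.

Lemma splice_infinite : infinite_set [set: G] -> infinite_set [set: splice].
Proof.
move=> Ginf; apply: contra_not Ginf => fin.
rewrite -(eq_finite_set (A := inl @` [set: G] : set splice)).
  exact: sub_finite_set fin.
by apply: inj_card_eq => x y _ _ [].
Qed.

Lemma splice_connected : 3 <= D -> graph_connected G -> graph_connected splice.
Proof.
move=> hD Gc; pose w := gadget_vertex ord0.
have wu : reachable w (inl u) by apply: reachable_adj; apply/asboolP; left.
have wv : reachable w (inl v) by apply: reachable_adj; apply/asboolP; right.
have inlR x y : reachable (inl x : splice) (inl y).
  have [p pP <-] := Gc x y; elim: p x pP => [|z p IH] x /=.
    by move=> _; exact: reachable_refl.
  move=> /andP[xz /IH]; apply: reachable_trans.
  (* The cut edge is replaced by a detour through [w]. *)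
  case: (boolP (cut_edge x z)) => [/asboolP[]|ncut].
  - by case=> -> ->; apply: reachable_trans wv; exact: reachable_sym.
  - by case=> -> ->; apply: reachable_trans wu; exact: reachable_sym.
  - by apply: reachable_adj; rewrite /= xz.
have lt2 : 2 < D.+3 by [].
have ltD : D.+1 < D.+3 by [].
have arcR (i j : 'I_D.+3) :
    gadget_adj D i j -> reachable (gadget_vertex i) (gadget_vertex j).
  by move=> ij; exact: reachable_adj.
(* From 0 one reaches 2, ..., D - 1 directly, D + 1 and D + 2 through 2, and then 1 and D through D
   + 1. *)
have w2 : reachable w (gadget_vertex (Ordinal lt2)).
  by apply: arcR; rewrite /gadget_adj /gadget_arc /=; lia.
have wD : reachable w (gadget_vertex (Ordinal ltD)).
  apply: reachable_trans w2 _; apply: arcR.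
  by rewrite /gadget_adj /gadget_arc /=; lia.
have wR x : reachable w x.
  case: x => [x|k]; first exact: reachable_trans wu (inlR _ _).
  rewrite gadget_vertexP; move: (Ordinal _) => i; have := ltn_ord i.
  case: (eqVneq i ord0) => [-> _|]; first exact: reachable_refl.
  rewrite -(inj_eq val_inj) /= => i0 iD.
  have [i1|i1] := boolP (1 < i < D).
    by apply: arcR; rewrite gadget_root_nbrs.
  have [iD1|iD1] := boolP (D < i).
    apply: reachable_trans w2 _; apply: arcR.
    by rewrite /gadget_adj /gadget_arc /=; case: ifP; lia.
  apply: reachable_trans wD _; apply: arcR; rewrite /gadget_adj /gadget_arc /=.
  by case: ifP; lia.
by move=> x y; apply: reachable_trans (wR y); exact: reachable_sym.
Qed.

(** A walk can notice the splicing only by leaving [u] or [v], and neither is within distance [r] of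
    [x]. *)
Lemma dist_ball_splice (x : G) (r : nat) :
  ~ dist_ball x r u -> ~ dist_ball x r v ->
  forall t, t <= r ->
  dist_ball (inl x : splice) t = inl @` dist_ball x t.
Proof.
move=> nu nv; elim=> [|t IH] tr.
  apply/seteqP; split => [y /dist_ball0 ->|_ [y /dist_ball0 -> <-]].
    by exists x => //; exact: dist_ball_center.
  exact: dist_ball_center.
have ncut z y : dist_ball x t z -> ~~ cut_edge z y.
  move=> tz; apply/asboolP => -[[zu _]|[zv _]]; [apply: nu|apply: nv]; subst z;
    by apply: dist_ball_le tz; exact: ltnW.
apply/seteqP; split => [y /dist_ballS|_ [y /dist_ballS + <-]].
  case=> [->|[_ /[!IH (ltnW tr)] -[z tz <-]]].
    by exists x => //; exact: dist_ball_center.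
  case: y => [y /andP[zy _]|k /andP[_ /asboolP zP]].
    by exists y => //; exact: dist_ball_step zy.
  by case: zP => E; subst z; [case: nu|case: nv];
    apply: dist_ball_le tz; exact: ltnW.
case=> [->|[z tz zy]]; first exact: dist_ball_center.
apply: (@dist_ball_step splice _ _ (inl z)).
  by rewrite IH 1?ltnW //; exists z.
by rewrite /= zy ncut.
Qed.

Hypotheses (hD : 3 <= D) (uv : adj u v).

Definition far_end (x : G) (y : G) : splice :=
  if cut_edge x y then gadget_vertex ord0 else inl y.

(** Each of [u] and [v] loses the other and gains vertex 0, so [far_end x] is a bijection between
    the two neighborhoods. *)
Lemma neighbors_splice_inl (x : G) :
  neighbors (inl x : splice) #= neighbors x.
Proof.
rewrite (_ : neighbors _ = far_end x @` neighbors x); last first.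
  apply/seteqP; split => [[y|k]|_ [y xy <-]] /=; rewrite /neighbors /=.
  - by move=> /andP[xy /negbTE ncut]; exists y => //; rewrite /far_end ncut.
  - rewrite gadget_vertexP => /andP[/eqP k0 /asboolP xP].
    have -> : Ordinal (svalP k) = ord0 by exact: val_inj.
    rewrite /far_end; case: xP => ->.
      by exists v; [exact: uv|rewrite cut_edge_uv].
    by exists u; [rewrite /= adj_sym; exact: uv|
      rewrite cut_edge_sym cut_edge_uv].
  - rewrite /far_end; case: ifPn => [/asboolP cut|ncut] /=.
      by apply/asboolP; case: cut => -[-> _]; [left|right].
    by rewrite ncut andbT.
apply: inj_card_eq => y z _ _; rewrite /far_end.
case: ifPn => [/asboolP|_]; case: ifPn => [/asboolP|_] //; last by move=> [].
have nuv : u <> v by move=> E; move: uv; rewrite E adj_irrefl.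
by case=> -[? ?]; case=> -[? ?]; subst.
Qed.

(* In [splice], the vertices 1 and D of the gadget, which are not adjacent to
   its vertex 0, are replaced by u and v in the neighborhood of 0. *)
Definition root_slot (j : 'I_D.+3) : splice :=
  if j == 1 :> nat then inl u else if j == D :> nat then inl v
  else gadget_vertex j.

Lemma root_slot_inj : injective root_slot.
Proof.
have nuv : u <> v by move=> E; move: uv; rewrite E adj_irrefl.
move=> i j; rewrite /root_slot.
have [i1|_] := eqVneq (i : nat) 1; have [j1|_] := eqVneq (j : nat) 1;
  have [iD|_] := eqVneq (i : nat) D; have [jD|_] := eqVneq (j : nat) D => //;
  move=> E; apply: val_inj => /=;
  first [lia | by case: E | by case: E => E; case: nuv].
Qed.

Lemma degree_gadget_vertex (i : 'I_D.+3) : neighbors (gadget_vertex i) #= `I_D.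
Proof.
have [->|i0] := eqVneq i ord0.
  rewrite -[X in `I_X](card_root_slots hD).
  rewrite (_ : neighbors _ =
    root_slot @` [set` [set j : 'I_D.+3 | 0 < j <= D]%SET]).
    exact: card_eq_image_set root_slot_inj.
  apply/seteqP; split => [[y|k] /= wy|_ [j /= + <-]].
  - have lt1 : 1 < D.+3 by [].
    have ltD : D < D.+3 by lia.
    case/asboolP: wy => ->.
      by exists (Ordinal lt1); rewrite //= inE /=; lia.
    exists (Ordinal ltD); first by rewrite /= inE /=; lia.
    by rewrite /root_slot /= eqxx ifF //; lia.
  - have := gadget_root_nbrs (Ordinal (svalP k)); rewrite /= [LHS]wy => kD.
    exists (Ordinal (svalP k)); first by rewrite /= inE /=; lia.
    by rewrite /root_slot gadget_vertexP /= !ifF //; lia.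
  - rewrite inE /root_slot => jD.
    case: ifPn => [_|j1]; first by apply/asboolP; left.
    case: ifPn => [_|jD']; first by apply/asboolP; right.
    by rewrite /neighbors /= gadget_root_nbrs; lia.
rewrite -[X in `I_X](gadget_degree hD i0).
rewrite (_ : neighbors _ =
    gadget_vertex @` [set` [set j : 'I_D.+3 | gadget_adj D i j]%SET]).
  exact: card_eq_image_set gadget_vertex_inj.
apply/seteqP; split => [[y|k] /= ik|_ [j /= + <-]].
- by case/andP: ik => /eqP ? _; case/eqP: i0; exact: val_inj.
- exists (Ordinal (svalP k)); last by rewrite -gadget_vertexP.
  by rewrite /= inE.
- by rewrite inE.
Qed.

Lemma splice_max_degree : max_degree_le G D -> max_degree_le splice D.
Proof.
move=> GD [x|k].
  by rewrite (card_le_eql (neighbors_splice_inl x)); exact: GD.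
have := degree_gadget_vertex (Ordinal (svalP k)).
by rewrite gadget_vertexP card_eq_le => /andP[].
Qed.

Lemma splice_regular : regular G D -> regular splice D.
Proof.
move=> GD [x|k]; last by rewrite gadget_vertexP; exact: degree_gadget_vertex.
exact: card_eq_trans (neighbors_splice_inl x) (GD x).
Qed.

End Splice.

(** * Splicing far from the root *)

Lemma splice_ball_iso (D : nat) (G : rooted_graph) (u v : G) (r : nat) :
  ~ dist_ball (Defs.root G) r u -> ~ dist_ball (Defs.root G) r v ->
  rooted_iso (rooted_ball G r)
    (rooted_ball (@RootedGraph (splice D u v) (inl (Defs.root G))) r).
Proof.
set x := Defs.root G => nu nv; pose H := @RootedGraph (splice D u v) (inl x).
have ballE := dist_ball_splice D nu nv (leqnn r).
have fP (y : rooted_ball G r) :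
    (inl (sval y) : H) \in dist_ball (Defs.root H) r.
  rewrite ballE; apply/mem_set; exists (sval y) => //.
  exact/set_mem/(svalP y).
pose f y := @in_rooted_ball H _ _ (fP y).
have gP (y : rooted_ball H r) : exists z, f z = y.
  have : (inl @` dist_ball x r) (sval y).
    by rewrite -ballE; apply/set_mem/(svalP y).
  move=> [z rz zy].
  by exists (in_rooted_ball (mem_set rz)); apply: val_inj.
have [g fg] := choice gP.
exists f; split.
- exists g => // y; apply: val_inj.
  by have : sval (f (g (f y))) = sval (f y) by [rewrite fg]; case.
- exact: val_inj.
- move=> y z; rewrite /= (_ : cut_edge _ _ _ _ = false) ?andbT //.
  apply/asboolP => -[[E _]|[E _]]; [apply: nu|apply: nv]; rewrite -E;
    exact/set_mem/(svalP y).
Qed.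

Lemma far_edge (G : sgraph) (D : nat) (x : G) (r : nat) :
  graph_connected G -> max_degree_le G D -> infinite_set [set: G] ->
  exists u v : G, [/\ adj u v, ~ dist_ball x r u & ~ dist_ball x r v].
Proof.
move=> Gc GD Ginf.
(* Balls are finite. Radius [r.+1] ensures that the vertex before [v] on a path from [x] is still
   outside the ball of radius [r]. *)
have [v nv] : exists v, ~ dist_ball x r.+1 v.
  apply/existsNP => all; apply: Ginf.
  by apply: sub_finite_set (finite_dist_ball r.+1 x GD) => y _; exact: all.
have nv' : ~ dist_ball x r v by move=> rv; apply: nv; exact: dist_ball_le rv.
have [p] := Gc x v; case/lastP: p => [|p z].
  by move=> _ E; case: nv; rewrite -E; exact: dist_ball_center.
rewrite rcons_path last_rcons => /andP[_ pz] E; subst z.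
exists (last x p), v; split=> // rp; apply: nv; exact: dist_ball_step pz.
Qed.

(** A large enough ball contains the whole gadget, so every [K] with an isomorphic ball contains a
    copy of it. *)
Lemma splice_ball_uncolorable (D : nat) (G : sgraph) (u v : G)
    (x : splice D u v) : 3 <= D -> graph_connected (splice D u v) ->
  exists s, forall K : rooted_graph,
    rooted_iso (rooted_ball (RootedGraph x) s) (rooted_ball K s) ->
    ~ edge_colorable K D.
Proof.
move=> hD Hc; have nP i : exists n, dist_ball x n (gadget_vertex u v i).
  by have [p pP lp] := Hc x (gadget_vertex u v i); exists (size p), p.
have [n nball] := choice nP.
exists (\max_i n i) => K [f [[g fK _] _ fadj]].
have iball i : gadget_vertex u v i \in dist_ball x (\max_i n i).
  by apply/mem_set; apply: dist_ball_le (nball i); exact: leq_bigmax.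
pose b i := @in_rooted_ball (RootedGraph x) _ _ (iball i).
apply: (@gadget_hom_uncolorable _ _ (fun i => sval (f (b i)))) => //.
  by move=> i j /val_inj/(can_inj fK) [] /val_inj.
by move=> i j ij; rewrite -[adj _ _]/(adj (f (b i)) (f (b j))) fadj.
Qed.

(** * Neighborhoods in the graph space and nowhere density *)

Lemma exp2V_lt (R : realType) (e : R) : (0 < e -> exists n, 2 ^- n < e)%R.
Proof.
move=> e0; exists (Num.bound e^-1%R).
have := upper_nthrootP (leqnn (Num.bound e^-1%R)).
by rewrite -[X in (_ < X)%R -> _]invrK ltf_pV2 // posrE ?invr_gt0 ?exprn_gt0.
Qed.

Lemma graph_space_ball_nbhs (R : realType) (D : nat)
    (G : bounded_rooted_graph D) (V : set (graph_space R D)) :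
  nbhs (\pi_(graph_space R D) G) V ->
  exists r, forall H : bounded_rooted_graph D,
    rooted_iso (rooted_ball G r) (rooted_ball H r) -> V (\pi H).
Proof.
move=> /nbhs_ballP[e /= /exp2V_lt[n ne] eV].
exists n => H GH; apply: eV; rewrite ballEmdist /=.
rewrite [mdist _ _]graph_dist_pi.
by apply: le_lt_trans (rooted_dist_le R GH) ne.
Qed.

(** All representatives [H] of [a] are covered, since membership in [colorable_graphs] supplies one
    that need not be [repr a]. *)
Lemma nbhs_graph_space_ball (R : realType) (D : nat)
    (G : bounded_rooted_graph D) (r : nat) :
  \forall a \near \pi_(graph_space R D) G, forall H : bounded_rooted_graph D,
    a = \pi H -> rooted_iso (rooted_ball G r) (rooted_ball H r).
Proof.
apply/nbhs_ballP; exists (2 ^- r)%R; first by rewrite /= invr_gt0 exprn_gt0.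
move=> _ /[swap] H /[swap] ->; rewrite ballEmdist /= [mdist _ _]graph_dist_pi.
by move=> /rooted_dist_lt; apply: rooted_ball_le.
Qed.

(** Reduces nowhere density to perturbing a graph outside a given ball so that some ball of the
    result forbids colorings. *)
Lemma nowhere_dense_in_colorable (R : realType) (D : nat) (P : set sgraph) :
  (forall (G : bounded_rooted_graph D) r, P G ->
    exists H : bounded_rooted_graph D, [/\ P H,
      rooted_iso (rooted_ball G r) (rooted_ball H r) &
      exists s, forall K : rooted_graph,
        rooted_iso (rooted_ball H s) (rooted_ball K s) ->
        ~ edge_colorable K D]) ->
  nowhere_dense_in (@graph_class R D P) (colorable_graphs R D).
Proof.
move=> PH _ [V Vo <-] [[a aP] Va].
have [G PG Ga] := set_mem aP; rewrite /= set_valE /= -Ga in Va.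
have [r rV] := graph_space_ball_nbhs (open_nbhs_nbhs (conj Vo Va)).
have [H [HP GH [s sP]]] := PH G r PG.
have piH : \pi_(graph_space R D) H \in @graph_class R D P.
  by apply/mem_set; exists H.
have := nbhs_graph_space_ball R H s; rewrite /prop_near1 nbhsE.
move=> -[W [Wo WH] Ws].
(* [V] keeps the set inside the given open set, [W] fixes the obstructing ball of radius [s], and
   the class of [H] lies in both. *)
exists (set_val @^-1` (V `&` W)); split.
- by exists (V `&` W) => //; exact: openI.
- exists (exist (fun x => x \in @graph_class R D P) _ piH).
  by rewrite /= set_valE /=; split=> //; exact: rV.
- by move=> b [].
- apply/seteqP; split=> // -[b bP] /=; rewrite set_valE /=.
  move=> [[_ /Ws bs] [K Kc Kb]].
  exact: sP (bs K _) Kc.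
Qed.

(** Isolates what the two cases share: a class of infinite graphs that is closed under splicing. *)
Lemma nowhere_dense_in_splice_closed (R : realType) (D : nat) (P : set sgraph) :
  3 <= D -> P `<=` [set G | infinite_set [set: G]] ->
  (forall (G : sgraph) (u v : G) (uv : adj u v), P G -> P (splice D u v)) ->
  nowhere_dense_in (@graph_class R D P) (colorable_graphs R D).
Proof.
move=> hD Pinf Psplice; apply: nowhere_dense_in_colorable => G r PG.
have [Gc GD] := (@bounded_connected _ G, @bounded_degree _ G).
have [u [v [uv ru rv]]] := @far_edge _ _ (Defs.root G) r Gc GD (Pinf _ PG).
have Hc := splice_connected (u := u) (v := v) hD Gc.
pose H := @BoundedRootedGraph D
  (@RootedGraph (splice D u v) (inl (Defs.root G))) Hc
  (splice_max_degree hD uv GD).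
exists H; split.
- exact: Psplice.
- exact: splice_ball_iso.
- exact: splice_ball_uncolorable.
Qed.

Theorem theorem3p10 (R : realType) (D : nat) (hD : 3 <= D) :
  nowhere_dense_in (infinite_graphs R D) (colorable_graphs R D) /\
  nowhere_dense_in (infinite_regular_graphs R D) (colorable_graphs R D).
Proof.
split; apply: nowhere_dense_in_splice_closed => //.
- by move=> G u v _; exact: splice_infinite.
- by move=> G [].
- move=> G u v uv [Ginf Greg]; split; first exact: splice_infinite.
  exact: splice_regular.
Qed.
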